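(* Let $k$, $(U,Q)$, $f$, $L$, $\beta$, $\langle\,,\rangle_\alpha$ be as below. There is a bijection between the set of $\mathrm{PO}(U)(k)$-orbits (under conjugation) on $V_f(k)$ and the set of classes $\alpha\in(L^\times/L^{\times2}k^\times)_{N=1}$ such that $\langle\,,\rangle_\alpha$ is split. Under this bijection the distinguished orbit corresponds to $\alpha=1$. Moreover, two $\mathrm{O}(U)(k)$-orbits corresponding (via the bijection between $\mathrm{O}(U)(k)$-orbits on $V_f(k)$ and classes $\alpha\in(L^\times/L^{\times2})_{N=1}$ with $\langle\,,\rangle_\alpha$ split) to $\alpha_1,\alpha_2\in(L^\times/L^{\times2})_{N=1}$ are $\mathrm{PO}(U)(k)$-equivalent if and only if $\alpha_1$ and $\alpha_2$ have the same image in $(L^\times/L^{\times2}k^\times)_{N=1}$.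
   Context: $k$ is a field of characteristic not $2$; $(U,Q)$ is the split quadratic space over $k$ of dimension $2n+2$ and discriminant $1$, with bilinear form $\langle v,w\rangle=Q(v+w)-Q(v)-Q(w)$; $f\in k[x]$ is monic of degree $2n+2$ with no repeated roots; $V_f(k)$ is the set of $k$-linear self-adjoint operators on $U$ with characteristic polynomial $f$; $\mathrm{O}(U)$ and $\mathrm{PO}(U)=\mathrm{O}(U)/\mu_2$ act by conjugation. $L=k[x]/f(x)$, $\beta$ the image of $x$; $(L^\times/L^{\times2})_{N=1}$ and $(L^\times/L^{\times2}k^\times)_{N=1}$ denote the elements whose norm to $k^\times/k^{\times2}$ is trivial. For $\alpha\in L^\times$, $\langle\lambda,\mu\rangle_\alpha=\mathrm{Tr}_{L/k}(\alpha\lambda\mu/f'(\beta))$; splitness depends only on the class of $\alpha$ in $L^\times/L^{\times2}k^\times$. The form $\langle\,,\rangle_1$ is split of discriminant $1$; choosing an isometry $\iota:(L,\langle\,,\rangle_1)\to(U,\langle\,,\rangle)$, put $T_f=\iota\circ(\cdot\beta)\circ\iota^{-1}$. The distinguished orbit is the $\mathrm{PO}(U)(k)$-orbit of $T_f$. *)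

(* Defs.v *)
From HB Require Import structures.
From mathcomp Require Import all_boot all_order all_algebra all_field.
Set Implicit Arguments.
Unset Strict Implicit.
Unset Printing Implicit Defensive.
Import GRing.Theory.
Local Open Scope ring_scope.

Section Defs.
Variables (k : fieldType) (n : nat).

Notation m := (n.+1 + n.+1)%N.

Definition hypQ (x : 'cV[k]_m) : k :=
  \sum_(i < n.+1) x (lshift n.+1 i) 0 * x (rshift n.+1 i) 0.

Definition bform (v w : 'cV[k]_m) : k := hypQ (v + w) - hypQ v - hypQ w.

Definition selfadjoint (T : 'M[k]_m) : Prop :=
  forall v w, bform (T *m v) w = bform v (T *m w).

Definition inVf (f : {poly k}) (T : 'M[k]_m) : Prop :=
  selfadjoint T /\ char_poly T = f.

Definition similitude (g : 'M[k]_m) : Prop :=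
  g \in unitmx /\ exists lam : k, lam != 0 /\ forall v, hypQ (g *m v) = lam * hypQ v.

(* PO(U)(k) = GO(U)(k)/k^x, acting by conjugation *)
Definition POequiv (T1 T2 : 'M[k]_m) : Prop :=
  exists g, similitude g /\ T2 = g *m T1 *m invmx g.

Variable f : {poly k}.
Notation L := {poly %/ f}.
Definition beta : L := 'qX.

Definition lcoord (x : L) : 'cV[k]_m := \col_(i < m) (x : {poly k})`_i.

Definition mulM (a : L) : 'M[k]_m :=
  \matrix_(i < m, j < m) ((a * beta ^+ j : L) : {poly k})`_i.

Definition trL (a : L) : k := \tr (mulM a).
Definition normL (a : L) : k := \det (mulM a).

Definition fprime : L := in_qpoly f f^`().

Definition formL (alpha lam mu : L) : k := trL (alpha * lam * mu / fprime).

Definition splitL (alpha : L) : Prop :=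
  exists W : {vspace L}, \dim W = n.+1 /\ {in W &, forall x y, formL alpha x y = 0}.

Definition sameclass (a1 a2 : L) : Prop :=
  exists (c : L) (t : k), c \is a GRing.unit /\ t != 0 /\ a1 = t *: (c ^+ 2 * a2).

Definition normOK (a : L) : Prop :=
  a \is a GRing.unit /\ exists c : k, normL a = c ^+ 2.

(* T corresponds to alpha (the O(U)(k)-orbit correspondence): there is a
   k-linear isometry phi : (L,<,>_alpha) -> (U,<,>) with phi(beta l) = T phi(l). *)
Definition corresp (T : 'M[k]_m) (alpha : L) : Prop :=
  exists P : 'M[k]_m, P \in unitmx /\
    (forall lam mu : L, bform (P *m lcoord lam) (P *m lcoord mu) = formL alpha lam mu) /\
    (forall lam : L, P *m lcoord (beta * lam) = T *m (P *m lcoord lam)).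

End Defs.

(* Main.v *)
(* A self-adjoint T with separable characteristic polynomial f has a cyclic
   vector, so U is identified with L = k[x]/f and T with multiplication by beta.
   The transported form is (x, y) |-> l(xy) for a linear functional l, and since
   tr(z / f'(beta)) is the coefficient of beta^(m-1) in z (Euler), which is a
   nondegenerate functional, it equals <,>_alpha for a unique unit alpha.
   Conversely a form <,>_alpha with an isotropic subspace of half dimension is
   isometric to the hyperbolic form.  Similitudes intertwining two operators are
   exactly the multiplications by a unit c of L, which scale alpha by c^2 up to
   the multiplier.  The norm of alpha is a square because <,>_1 is itself
   hyperbolic, the span of the beta^i with i < m/2 being isotropic. *)
Require Import Defs.
From HB Require Import structures.
From mathcomp Require Import all_boot all_order all_algebra all_field ring.
From Stdlib Require Import ClassicalEpsilon.
Import GRing.Theory.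
Local Open Scope ring_scope.

Set Implicit Arguments.
Unset Strict Implicit.
Unset Printing Implicit Defensive.

(** * Cyclic vectors *)

(** Reducibility is undecidable over a general field, so excluded middle decides whether a proper
    divisor exists; descent on the size does the rest. *)
Lemma irreducible_factor (F : fieldType) (q : {poly F}) :
  (1 < size q)%N -> exists2 p, irreducible_poly p & p %| q.
Proof.
have [s] := ubnP (size q); elim: s q => // s IHs q lt_q_s q_gt1.
have [[d [d_gt1 lt_d_q d_q]]|no_d] :=
    classic (exists d : {poly F},
      [/\ (1 < size d)%N, (size d < size q)%N & d %| q]).
  have [p irr_p p_d] := IHs d (leq_trans lt_d_q lt_q_s) d_gt1.
  by exists p => //; apply: dvdp_trans d_q.
exists q => //; split=> // d d_neq1 d_q; rewrite -dvdp_size_eqp //.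
have nz_q : q != 0 by rewrite -size_poly_gt0 ltnW.
have le_d_q := dvdp_leq nz_q d_q.
rewrite eqn_leq le_d_q leqNgt; apply/negP=> lt_d_q; case: no_d; exists d.
split=> //; rewrite ltn_neqAle eq_sym d_neq1 size_poly_gt0.
by apply: contraNneq nz_q => d0; rewrite -dvd0p -d0.
Qed.

(** Over an extension [K] where [p] has a root [z], [z] is an eigenvalue of [A], so [p(A)] has the
    singular factor [A - z]. Vanishing of the determinant descends along the embedding into [K]. *)
Lemma det_horner_mx_irreducible (F : fieldType) (m : nat) (A : 'M[F]_m.+1)
    (p : {poly F}) :
  irreducible_poly p -> p %| char_poly A -> \det (horner_mx A p) = 0.
Proof.
move=> irr_p p_A; have [K _ [z pz0 _]] := irredp_FAdjoin irr_p.
have Az : eigenvalue (map_mx (in_alg K) A) z.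
  rewrite eigenvalue_root_char -map_char_poly.
  by move: p_A => /dvdpP[r ->]; rewrite rmorphM rootM pz0 orbT.
have /eigenvalueP[v Av nz_v] := Az.
apply: (fmorph_inj (in_alg K)); rewrite rmorph0 -det_map_mx map_horner_mx.
have /factor_theorem[r ->] := pz0.
rewrite rmorphM /= det_mulmx rmorphB /= horner_mx_X horner_mx_C.
suff /eqP-> : \det (map_mx (in_alg K) A - z%:M) == 0 by rewrite mulr0.
by apply/det0P; exists v => //; rewrite mulmxBr Av mul_mx_scalar subrr.
Qed.

(* A vector annihilated exactly by [q] is built one irreducible factor at a
   time, adding a vector annihilated exactly by the new, coprime, factor. *)
Lemma cyclic_vector (F : fieldType) (m : nat) (A : 'M[F]_m.+1) :
  separable_poly (char_poly A) ->
  exists v : 'rV_m.+1, forall h : {poly F},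
    v *m horner_mx A h = 0 -> char_poly A %| h.
Proof.
move=> sepA.
have hornerM (g h : {poly F}) :
  horner_mx A (g * h) = horner_mx A g *m horner_mx A h by exact: rmorphM.
suff ann (q : {poly F}) : q %| char_poly A -> exists2 v : 'rV_m.+1,
    v *m horner_mx A q = 0 & forall h : {poly F}, v *m horner_mx A h = 0 -> q %| h.
  by have [v _ v_min] := ann _ (dvdpp _); exists v.
have [s] := ubnP (size q); elim: s q => // s IHs q lt_q_s q_A.
have nz_q : q != 0.
  by apply: contraNneq (monic_neq0 (char_poly_monic A)) => q0; rewrite -dvd0p -q0.
have [q_le1|q_gt1] := leqP (size q) 1.
  exists 0 => [|h _]; first by rewrite mul0mx.
  have q_eq1 : q %= 1 by rewrite -size_poly_eq1 eqn_leq q_le1 size_poly_gt0.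
  by rewrite (eqp_dvdl _ q_eq1) dvd1p.
have [p irr_p p_q] := irreducible_factor q_gt1.
have p_gt1 : (1 < size p)%N by case: irr_p.
have /dvdpP[r Dq] := p_q.
have [nz_r nz_p] : r != 0 /\ p != 0.
  by apply/andP; rewrite -negb_or -mulf_eq0 -Dq.
have lt_r_q : (size r < size q)%N.
  rewrite Dq size_mul // -(prednK (ltnW p_gt1)) addnS /= -addn1.
  by rewrite leq_add2l -ltnS (ltn_predK p_gt1).
have co_r_p : coprimep r p by apply: separable_coprime sepA _; rewrite -Dq.
have r_A : r %| char_poly A by apply: dvdp_trans q_A; rewrite Dq dvdp_mulr.
have [v vr0 v_min] := IHs r (leq_trans lt_r_q lt_q_s) r_A.
have /eqP/det0P[w nz_w wp0] :=
  det_horner_mx_irreducible irr_p (dvdp_trans p_q q_A).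
(* If [p] did not divide [h], a Bezout relation between them would make [w] vanish. *)
have w_min h : w *m horner_mx A h = 0 -> p %| h.
  move=> wh0; apply: contraNT nz_w; rewrite -irreducible_poly_coprime // => co.
  have /Bezout_eq1_coprimepP[[a b] /= eq1] := co.
  rewrite -[w]mulmx1 -[1%:M](rmorph1 (horner_mx A)) -eq1 rmorphD /=.
  by rewrite mulrC (mulrC b) !hornerM mulmxDr !mulmxA wp0 wh0 !mul0mx addr0.
exists (v + w) => [|h vwh0].
  rewrite Dq mulmxDl {2}mulrC !hornerM !mulmxA.
  by rewrite vr0 wp0 !mul0mx addr0.
(* Taking [g = p] kills the [w] term and leaves [r] dividing [p * h]; taking [g = r] does the
   reverse. Coprimality then removes the extra factor. *)
have vw0 g : v *m horner_mx A (g * h) + w *m horner_mx A (g * h) = 0.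
  by rewrite -mulmxDl mulrC hornerM mulmxA vwh0 mul0mx.
have r_h : r %| h.
  rewrite -(Gauss_dvdpr _ co_r_p); apply: v_min.
  by have := vw0 p; rewrite [in X in _ + X]hornerM mulmxA wp0 mul0mx addr0.
have p_h : p %| h.
  rewrite -(Gauss_dvdpr _ (_ : coprimep p r)) 1?coprimep_sym //; apply: w_min.
  by have := vw0 r; rewrite hornerM mulmxA vr0 mul0mx add0r.
by rewrite Dq Gauss_dvdp // r_h.
Qed.

(** * Bilinear forms as matrices *)

Section Matrices.
Variable F : fieldType.

Lemma unitmx_inj_col (m : nat) (A : 'M[F]_m) :
  (forall v : 'cV_m, A *m v = 0 -> v = 0) -> A \in unitmx.
Proof.
move=> injA; rewrite -unitmx_tr -row_free_unit; apply: inj_row_free => v vA0.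
apply: trmx_inj; rewrite trmx0; apply: injA.
by rewrite -[A]trmxK -trmx_mul vA0 trmx0.
Qed.

Lemma mx_form_inj (m : nat) (A B : 'M[F]_m) :
  (forall v w : 'cV_m, (v^T *m A *m w) 0 0 = (v^T *m B *m w) 0 0) -> A = B.
Proof.
move=> eqAB; apply/matrixP=> i j.
have := eqAB (delta_mx i 0) (delta_mx j 0).
by rewrite !trmx_delta -!rowE -!colE !mxE.
Qed.

Lemma mx_form_tr (m : nat) (A : 'M[F]_m) (v w : 'cV_m) :
  (v^T *m A^T *m w) 0 0 = (w^T *m A *m v) 0 0.
Proof.
have -> : v^T *m A^T *m w = (w^T *m A *m v)^T by rewrite !trmx_mul trmxK mulmxA.
by rewrite mxE.
Qed.

Lemma horner_mx_tr (m : nat) (A : 'M[F]_m.+1) (p : {poly F}) :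
  horner_mx A^T p = (horner_mx A p)^T.
Proof.
elim/poly_ind: p => [|p c IHp]; first by rewrite !rmorph0 trmx0.
rewrite !rmorphD !rmorphM /= !horner_mx_X !horner_mx_C IHp linearD /=.
rewrite tr_scalar_mx; congr (_ + _).
have -> : horner_mx A p * A = A * horner_mx A p.
  exact/esym/comm_mx_horner.
exact: esym (trmx_mul _ _).
Qed.

Lemma horner_mx_selfadjoint (m : nat) (A G : 'M[F]_m.+1) (p : {poly F}) :
  A^T *m G = G *m A -> (horner_mx A p)^T *m G = G *m horner_mx A p.
Proof.
move=> saA; rewrite -horner_mx_tr.
elim/poly_ind: p => [|p c IHp]; first by rewrite !rmorph0 mul0mx mulmx0.
rewrite !rmorphD !rmorphM /= !horner_mx_X !horner_mx_C mulmxDl mulmxDr.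
rewrite -scalar_mxC; congr (_ + _).
by rewrite -[LHS]mulmxA saA mulmxA IHp -mulmxA.
Qed.

Lemma char_poly_trmx (m : nat) (A : 'M[F]_m) : char_poly A^T = char_poly A.
Proof.
rewrite /char_poly -[RHS]det_tr /char_poly_mx linearB /= tr_scalar_mx.
by rewrite map_trmx.
Qed.

Lemma mx_col_inj (m : nat) (A B : 'M[F]_m) :
  (forall v : 'cV_m, A *m v = B *m v) -> A = B.
Proof.
move=> eqAB; apply/matrixP=> i j; have := eqAB (delta_mx j 0).
by rewrite -!colE => /colP/(_ i); rewrite !mxE.
Qed.

Definition hyp_mx (s : nat) : 'M[F]_(s + s) := block_mx 0 1%:M 1%:M 0.

Lemma hyp_mx_sqr (s : nat) : hyp_mx s *m hyp_mx s = 1%:M.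
Proof.
by rewrite mulmx_block !mulmx0 !mul0mx !mulmx1 !addr0 add0r -scalar_mx_block.
Qed.

Lemma det_hyp_mx_neq0 (s : nat) : \det (hyp_mx s) != 0.
Proof.
have := oner_neq0 F; rewrite -(det1 F (s + s)) -hyp_mx_sqr det_mulmx.
by apply: contraNneq => ->; rewrite mul0r.
Qed.

(** Write [G] in blocks [0, B, B^T, D]. The witness splits [D] into two equal halves, one from each
    side of the symmetric product, which is where [2] must be invertible. *)
Lemma hyp_mx_factor (s : nat) (G : 'M[F]_(s + s)) :
  (2%:R : F) != 0 -> G^T = G -> ulsubmx G = 0 ->
  exists P : 'M_(s + s), P^T *m hyp_mx s *m P = G.
Proof.
move=> nz2; rewrite -[G]submxK tr_block_mx => /eq_block_mx[_ _ Gdl Gdr].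
rewrite block_mxKul => Gul; set B := ursubmx G in Gdl *; set D := drsubmx G in Gdr *.
exists (block_mx B^T (2%:R^-1 *: D) 0 1%:M).
rewrite tr_block_mx !mulmx_block !trmx0 trmx1 trmxK !linearZ /= Gdr Gul -Gdl.
rewrite !(mulmx0, mul0mx, mulmx1, mul1mx, scaler0, addr0, add0r); congr block_mx.
by rewrite -[LHS]mulr2n -scaler_nat scalerA mulfV // scale1r.
Qed.

(** The invertible [row_ebase A] has as its first [s] rows a basis of the row space of [A];
    [col_ebase A] is the change of basis between these and the rows of [A]. *)
Lemma rebase_isotropic (s m : nat) (G : 'M[F]_(s + m)) (A : 'M_(s, s + m)) :
  row_free A -> A *m G *m A^T = 0 ->
  exists2 Q, Q \in unitmx & ulsubmx (Q *m G *m Q^T) = 0.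
Proof.
move=> freeA A0; exists (row_ebase A); first exact: row_ebase_unit.
have eqA : A = col_ebase A *m usubmx (row_ebase A).
  rewrite -{1}[A]mulmx_ebase (eqP freeA) -{1}[row_ebase A]vsubmxK -mulmxA.
  by rewrite pid_mx_row mul_row_col mul1mx mul0mx addr0.
have uC := col_ebase_unit A.
move: A0; rewrite {1 2}eqA trmx_mul.
set C := col_ebase A; set U := usubmx _ => A0.
have : invmx C *m (C *m U *m G *m (U^T *m C^T)) *m invmx C^T = 0.
  by rewrite A0 mulmx0 mul0mx.
rewrite !mulmxA mulVmx // mul1mx mulmxK ?unitmx_tr // => U0.
rewrite -{1 2}[row_ebase A]vsubmxK -/U tr_col_mx mul_col_mx mul_col_row.
by rewrite block_mxKul.
Qed.

Lemma bformE (n : nat) (v w : 'cV[F]_(n.+1 + n.+1)) :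
  bform v w = (v^T *m hyp_mx n.+1 *m w) 0 0.
Proof.
have hypQE (x : 'cV[F]_(n.+1 + n.+1)) : hypQ x = ((usubmx x)^T *m dsubmx x) 0 0.
  by rewrite mxE; apply: eq_bigr => i _; rewrite !mxE.
rewrite -[v]vsubmxK -[w]vsubmxK.
set a := usubmx v; set b := dsubmx v; set c := usubmx w; set d := dsubmx w.
rewrite tr_col_mx mul_row_block !mulmx0 !mulmx1 addr0 add0r mul_row_col.
rewrite /bform !hypQE add_col_mx !col_mxKu !col_mxKd.
have cb : c^T *m b = (b^T *m c)^T by rewrite trmx_mul trmxK.
rewrite [(a + c)^T]linearD mulmxDl !mulmxDr cb !mxE.
ring.
Qed.

Lemma bform_diag (n : nat) (v : 'cV[F]_(n.+1 + n.+1)) :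
  bform v v = 2%:R * hypQ v.
Proof.
have -> : bform v v = hypQ (v + v) - hypQ v - hypQ v by [].
have -> : hypQ (v + v) = 4%:R * hypQ v.
  by rewrite mulr_sumr; apply: eq_bigr => i _; rewrite !mxE; ring.
ring.
Qed.

Lemma bform_similitude (n : nat) (g : 'M[F]_(n.+1 + n.+1)) (lam : F) v w :
  (forall v, hypQ (g *m v) = lam * hypQ v) ->
  bform (g *m v) (g *m w) = lam * bform v w.
Proof. by move=> hg; rewrite /bform -mulmxDr !hg !mulrBr. Qed.

End Matrices.

(** * The algebra k[x]/f and its trace forms *)

Section Etale.
Variables (k : fieldType) (n : nat) (f : {poly k}).
Hypotheses (f_monic : f \is monic) (size_f : size f = (n.+1 + n.+1).+1).
Hypothesis f_sep : separable_poly f.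
Hypothesis nz2 : (2%:R : k) != 0.

Notation m := (n.+1 + n.+1)%N.
Notation L := {poly %/ f}.
Notation betaL := (beta f).
Notation inL := (in_qpoly f).
Notation lcoord := (@lcoord k n f).
Notation mulM := (@mulM k n f).

Lemma mk_monic_id : mk_monic f = f.
Proof. by rewrite /mk_monic f_monic size_f. Qed.

Lemma size_qpoly (x : L) : (size (x : {poly k}) <= m)%N.
Proof.
have := size_mk_monic x.
by rewrite [mk_monic f in X in (_ < X)%N]mk_monic_id size_f.
Qed.

Lemma in_qpolyK (x : L) : inL (x : {poly k}) = x.
Proof. exact/val_inj/in_qpoly_small/size_mk_monic. Qed.

Lemma in_qpoly_id (p : {poly k}) : (size p <= m)%N -> inL p = p :> {poly k}.
Proof. by move=> sp; rewrite in_qpoly_small // mk_monic_id size_f ltnS. Qed.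

Lemma in_qpoly_eq0 (p : {poly k}) : (inL p == 0) = (f %| p).
Proof.
rewrite -val_eqE /= mk_monic_id -/(Pdiv.CommonRing.rdvdp _ _).
by rewrite -Pdiv.Idomain.dvdpE.
Qed.

Lemma in_qpolyX : inL 'X = betaL. Proof. by []. Qed.

Lemma in_qpoly_coef (x : L) : x = \sum_(i < m) (x : {poly k})`_i *: betaL ^+ i.
Proof.
have -> : \sum_(i < m) (x : {poly k})`_i *: betaL ^+ i =
    inL (\poly_(i < m) (x : {poly k})`_i).
  rewrite poly_def linear_sum /=; apply: eq_bigr => i _.
  by rewrite linearZ /= rmorphXn /= in_qpolyX.
rewrite -[LHS]in_qpolyK; congr (inL _); apply/polyP => i; rewrite coef_poly.
by case: ltnP => // le_m_i; rewrite nth_default // (leq_trans (size_qpoly x)).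
Qed.

Definition lvec (v : 'cV[k]_m) : L := inL (rVpoly v^T).

Lemma lvecK : cancel lvec lcoord.
Proof.
move=> v; apply/colP=> i; rewrite mxE in_qpoly_id ?size_poly //.
by rewrite coef_rVpoly_ord mxE.
Qed.

Lemma lcoordK : cancel lcoord lvec.
Proof.
move=> x; rewrite -[RHS]in_qpolyK; congr (inL _); apply/polyP=> i.
rewrite coef_rVpoly; case: insubP => [j _ <-|]; first by rewrite !mxE.
by rewrite -leqNgt => le_m_i; rewrite nth_default // (leq_trans (size_qpoly x)).
Qed.

Lemma lcoord_is_linear : linear lcoord.
Proof. by move=> a x y; apply/colP=> i; rewrite !mxE coefD coefZ. Qed.
HB.instance Definition _ :=
  GRing.isLinear.Build k L 'cV[k]_m _ lcoord lcoord_is_linear.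

Lemma mulM_lcoord (a b : L) : mulM a *m lcoord b = lcoord (a * b).
Proof.
rewrite {2}[b]in_qpoly_coef mulr_sumr linear_sum; apply/colP=> i.
rewrite !mxE summxE; apply: eq_bigr => j _.
by rewrite !mxE -scalerAr coefZ mulrC.
Qed.

(** In finite dimension an injective multiplication is bijective, so it reaches [1]. *)
Lemma unitr_inj (a : L) : (forall b, a * b = 0 -> b = 0) -> a \is a GRing.unit.
Proof.
move=> inja; have uM : mulM a \in unitmx.
  apply: unitmx_inj_col => v av0.
  rewrite -[v]lvecK (inja (lvec v)) ?linear0 //; apply: (can_inj lcoordK).
  by rewrite -mulM_lcoord lvecK av0 linear0.
apply/unitrPr; exists (lvec (invmx (mulM a) *m lcoord 1)).
by apply: (can_inj lcoordK); rewrite -mulM_lcoord lvecK mulKVmx.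
Qed.

Lemma unitmx_mulM (a : L) : a \is a GRing.unit -> mulM a \in unitmx.
Proof.
move=> ua; apply: unitmx_inj_col => v av0.
rewrite -[v]lvecK (_ : lvec v = 0) ?linear0 //; apply: (mulrI ua).
by apply: (can_inj lcoordK); rewrite mulr0 linear0 -mulM_lcoord lvecK.
Qed.

(** * The top coefficient functional and Euler's trace formula *)

Definition topcoef (x : L) : k := (x : {poly k})`_(n + n.+1).

Lemma topcoefD : {morph topcoef : x y / x + y}.
Proof. by move=> x y; rewrite /topcoef coefD. Qed.

Lemma topcoefZ (c : k) (x : L) : topcoef (c *: x) = c * topcoef x.
Proof. by rewrite /topcoef coefZ. Qed.

Lemma coef_beta_mul (x : L) (j : nat) : (j.+1 < m)%N ->
  (betaL * x : {poly k})`_j.+1 = (x : {poly k})`_j - f`_j.+1 * topcoef x.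
Proof.
move=> lt_j_m.
(* Subtracting [topcoef x *: f] cancels the term of degree [m], so the representative is already
   reduced. *)
have -> : betaL * x = inL ('X * (x : {poly k}) - topcoef x *: f).
  rewrite linearB linearZ /= rmorphM /= in_qpolyK.
  by have /eqP-> : inL f == 0; rewrite ?in_qpoly_eq0 // scaler0 subr0.
rewrite in_qpoly_id; first by rewrite coefB coefZ coefXM mulrC.
apply/leq_sizeP => i; rewrite leq_eqVlt => /predU1P[<-|lt_m_i].
  rewrite coefB coefZ coefXM /= -/(topcoef x).
  have -> : f`_m = 1 by have := monicP f_monic; rewrite lead_coefE size_f.
  by rewrite mulr1 subrr.
rewrite coefB coefZ coefXM; case: i lt_m_i => // i lt_m_i /=.
by rewrite !nth_default ?mulr0 ?subrr // ?size_f // (leq_trans (size_qpoly x)).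
Qed.

(* The coefficients of f / (X - beta): they form the basis dual to the powers of
   beta for the functional topcoef. *)
Definition dual_beta (j : nat) : L := inL (drop_poly j.+1 f).

(** One step of Horner's scheme for [f]. *)
Lemma drop_poly_rec (j : nat) :
  drop_poly j f = (f`_j)%:P + 'X * drop_poly j.+1 f.
Proof.
apply/polyP=> -[|i]; rewrite coefD coefC coefXM !coef_drop_poly /= ?addr0 //.
by rewrite add0r addnS.
Qed.

Lemma drop_poly_top : drop_poly m f = 1.
Proof.
apply/polyP=> -[|i]; rewrite coef_drop_poly coef1 /=.
  by rewrite add0n; have := monicP f_monic; rewrite lead_coefE size_f.
by rewrite nth_default // size_f addSn ltnS leq_addl.
Qed.

(** Descending induction from [j = m - 1], where [dual_beta j] is [1]: the Horner recursion for
    [dual_beta] supplies exactly the correction term of [coef_beta_mul]. *)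
Lemma topcoef_dual_beta (x : L) (j : nat) : (j < m)%N ->
  topcoef (dual_beta j * x) = (x : {poly k})`_j.
Proof.
move=> lt_j_m; have [s] : exists s, (j + s = n + n.+1)%N.
  by exists (n + n.+1 - j)%N; rewrite subnKC.
elim: s j x lt_j_m => [|s IHs] j x lt_j_m Dj.
  rewrite addn0 in Dj; by rewrite /dual_beta Dj drop_poly_top rmorph1 mul1r.
have lt_j1_m : (j.+1 < m)%N.
  by rewrite -[m]/((n + n.+1).+1) -Dj addnS !ltnS leq_addr.
have := IHs j.+1 (betaL * x) lt_j1_m; rewrite addSnnS => /(_ Dj).
rewrite coef_beta_mul // => /eqP; rewrite eq_sym subr_eq => /eqP->.
rewrite {1}/dual_beta drop_poly_rec rmorphD rmorphM /= in_qpolyX.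
rewrite -alg_polyC linearZ /= rmorph1 mulrDl topcoefD -scalerAl mul1r topcoefZ addrC.
by rewrite -[inL _]/(dual_beta j.+1) mulrCA mulrA.
Qed.

(** The sum is [f / (X - beta)] evaluated at [X = beta]. The proof differentiates Horner's scheme
    one step at a time. *)
Lemma fprime_sum : fprime f = \sum_(j < m) dual_beta j * betaL ^+ j.
Proof.
have derf s :
    f^`() = \sum_(j < s) drop_poly j.+1 f * 'X^j + (drop_poly s f)^`() * 'X^s.
  elim: s => [|s IHs]; first by rewrite big_ord0 add0r mulr1 drop_poly0l.
  rewrite big_ord_recr /= {}IHs -addrA; congr (_ + _).
  rewrite drop_poly_rec derivD derivC add0r derivM derivX mul1r exprS.
  by rewrite mulrDl mulrA (mulrC _ 'X).
rewrite /fprime (derf m) drop_poly_top derivC mul0r addr0 rmorph_sum.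
by apply: eq_bigr => j _; rewrite rmorphM rmorphXn.
Qed.

(** The diagonal entries of [mulM a] are read off with the dual basis, and [fprime_sum] adds them
    up. *)
Lemma trL_topcoef (a : L) : trL n a = topcoef (a * fprime f).
Proof.
rewrite fprime_sum mulr_sumr.
transitivity (\sum_(i < m) topcoef (dual_beta i * (a * betaL ^+ i))).
  by apply: eq_bigr => i _; rewrite topcoef_dual_beta // mxE.
rewrite [RHS](big_morph topcoef topcoefD (_ : _ = 0)); last exact: coef0.
by apply: eq_bigr => i _; rewrite mulrCA.
Qed.

(** Reducing a Bezout relation between [f] and its derivative modulo [f] exhibits the inverse. *)
Lemma unitr_fprime : fprime f \is a GRing.unit.
Proof.
have : coprimep f f^`() by move: f_sep; rewrite unlock.
move=> /Bezout_eq1_coprimepP[[u v] /= eq1].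
apply/unitrPr; exists (inL v); rewrite -rmorphM -[RHS](rmorph1 inL) -eq1.
rewrite rmorphD (mulrC v) [X in X + _](_ : _ = 0) ?add0r //.
by apply/eqP; rewrite in_qpoly_eq0 dvdp_mull.
Qed.

Lemma formL_topcoef (a x y : L) : formL n a x y = topcoef (a * x * y).
Proof. by rewrite /formL trL_topcoef divrK ?unitr_fprime. Qed.

Lemma topcoef_eq0 (x : L) : (forall y, topcoef (x * y) = 0) -> x = 0.
Proof.
move=> x0; apply: (can_inj lcoordK); apply/colP=> i; rewrite !mxE coef0.
by rewrite -topcoef_dual_beta // mulrC x0.
Qed.

Lemma topcoef_is_scalar : scalar topcoef.
Proof. by move=> c x y; rewrite topcoefD topcoefZ. Qed.
HB.instance Definition _ := GRing.isLinear.Build k L k _ topcoef topcoef_is_scalar.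

(** * Gram matrices of the trace forms *)

Notation H := (hyp_mx k n.+1).

Definition gram : 'M[k]_m := \matrix_(i, j) topcoef (betaL ^+ i * betaL ^+ j).

Lemma gramE (x y : L) : ((lcoord x)^T *m gram *m lcoord y) 0 0 = topcoef (x * y).
Proof.
rewrite [in RHS](in_qpoly_coef y) mulr_sumr linear_sum mxE.
apply: eq_bigr => j _; rewrite -scalerAr linearZ mxE /= mulrC !mxE.
congr (_ * _); rewrite [in RHS](in_qpoly_coef x) mulr_suml linear_sum.
by apply: eq_bigr => i _; rewrite -scalerAl linearZ !mxE.
Qed.

Lemma gram_mulM (a x y : L) :
  ((lcoord x)^T *m (gram *m mulM a) *m lcoord y) 0 0 = formL n a x y.
Proof.
by rewrite !mulmxA -mulmxA mulM_lcoord // gramE formL_topcoef mulrCA mulrA.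
Qed.

(** Since [gram] represents the form for [1] in the power basis, [gram *m mulM a] represents the
    form for [a]. *)
Lemma isometry_mxP (P : 'M[k]_m) (a : L) :
  (forall x y, bform (P *m lcoord x) (P *m lcoord y) = formL n a x y) <->
  P^T *m H *m P = gram *m mulM a.
Proof.
have bformP x y : bform (P *m lcoord x) (P *m lcoord y) =
    ((lcoord x)^T *m (P^T *m H *m P) *m lcoord y) 0 0.
  by rewrite bformE trmx_mul !mulmxA.
split=> [isoP|eqP x y]; last by rewrite bformP eqP gram_mulM.
apply: mx_form_inj => v w.
by rewrite -[v]lvecK -[w]lvecK -bformP isoP gram_mulM.
Qed.

Lemma unitmx_gram : gram \in unitmx.
Proof.
apply: unitmx_inj_col => v Gv0; rewrite -[v]lvecK.
have -> : lvec v = 0; last by rewrite linear0.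
apply: topcoef_eq0 => y.
by rewrite mulrC -gramE lvecK -mulmxA Gv0 mulmx0 mxE.
Qed.

Lemma tr_gram_mulM (a : L) : (gram *m mulM a)^T = gram *m mulM a.
Proof.
apply: mx_form_inj => v w; rewrite -[v]lvecK -[w]lvecK gram_mulM.
by rewrite mx_form_tr gram_mulM !formL_topcoef mulrAC.
Qed.

(** For [i, j <= n] the monomial of degree [i + j <= 2n] needs no reduction and lies below the top
    degree [2n + 1]. *)
Lemma ulsubmx_gram : ulsubmx gram = 0.
Proof.
apply/matrixP=> i j; rewrite !mxE -exprD.
have le_ij : (i + j < n + n.+1)%N by rewrite addnS ltnS leq_add // -ltnS.
have -> : betaL ^+ (i + j) = inL 'X^(i + j) by rewrite rmorphXn.
rewrite /topcoef in_qpoly_id ?size_polyXn ?coefXn ?(gtn_eqF le_ij) //.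
exact: leqW.
Qed.

(** * Operators on U and their classes in L *)

Lemma beta_hom_horner (T P : 'M[k]_m) :
  (forall x, P *m lcoord (betaL * x) = T *m (P *m lcoord x)) ->
  forall p x, P *m lcoord (inL p * x) = horner_mx T p *m (P *m lcoord x).
Proof.
move=> homP; elim/poly_ind=> [|p c IHp] x.
  by rewrite !rmorph0 mul0r linear0 mulmx0 mul0mx.
rewrite !rmorphD !rmorphM /= horner_mx_X horner_mx_C mulrDl -mulrA in_qpolyX.
rewrite linearD mulmxDr IHp homP mulmxDl !mulmxA; congr (_ + _).
rewrite -alg_polyC linearZ /= rmorph1 -scalerAl mul1r linearZ /=.
by rewrite -scalemxAr mul_scalar_mx scalemxAl.
Qed.

Lemma corresp_unit (T : 'M[k]_m) (a : L) : corresp T a -> a \is a GRing.unit.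
Proof.
case=> P [uP [/isometry_mxP isoP _]]; apply: unitr_inj => b ab0.
have : gram *m mulM a \in unitmx.
  by rewrite -isoP !unitmx_mul unitmx_tr uP unitmxE unitfE det_hyp_mx_neq0.
rewrite unitmx_mul => /andP[_ uM]; apply: (can_inj lcoordK).
by rewrite -[LHS](mulKmx uM) mulM_lcoord // ab0 linear0 mulmx0.
Qed.

(** The isotropic subspace is the preimage under [P] of the span of the first [n + 1] standard basis
    vectors, on which [hypQ] vanishes. *)
Lemma corresp_splitL (T : 'M[k]_m) (a : L) : corresp T a -> splitL n a.
Proof.
case=> P [uP [isoP _]].
pose X := [tuple lvec (invmx P *m delta_mx (lshift n.+1 i) 0) | i < n.+1].
have XE (i : 'I_n.+1) : X`_i = lvec (invmx P *m delta_mx (lshift n.+1 i) 0).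
  by rewrite -tnth_nth tnth_mktuple.
have PX (c : 'I_n.+1 -> k) : P *m lcoord (\sum_(i < n.+1) c i *: X`_i) =
    \sum_(i < n.+1) c i *: delta_mx (lshift n.+1 i) 0.
  rewrite linear_sum mulmx_sumr; apply: eq_bigr => i _.
  by rewrite linearZ /= XE lvecK -scalemxAr mulKVmx.
have PXE (c : 'I_n.+1 -> k) j : (P *m lcoord (\sum_(i < n.+1) c i *: X`_i)) j 0 =
    \sum_(i < n.+1) c i * (j == lshift n.+1 i)%:R.
  by rewrite PX summxE; apply: eq_bigr => i _; rewrite !mxE eqxx andbT.
have freeX : free X.
  apply/freeP => c c0 i; have := PXE c (lshift n.+1 i).
  rewrite c0 linear0 mulmx0 mxE (bigD1 i) //= eqxx mulr1 big1 ?addr0 // => j ne_ji.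
  by rewrite (inj_eq (@lshift_inj _ _)) eq_sym (negPf ne_ji) mulr0.
exists <<X>>%VS; split; first by rewrite (eqnP freeX) size_tuple.
have isoX x : x \in <<X>>%VS -> hypQ (P *m lcoord x) = 0.
  move=> /coord_span ->; apply: big1 => i _; rewrite [X in _ * X]PXE.
  by rewrite [X in _ * X]big1 ?mulr0 // => j _; rewrite eq_rlshift mulr0.
move=> x y Wx Wy; rewrite -isoP /bform -mulmxDr -linearD.
by rewrite !isoX ?rpredD // !subr0.
Qed.

Lemma gram_factor : exists2 P : 'M[k]_m, P^T *m H *m P = gram & P \in unitmx.
Proof.
have trG : gram^T = gram.
  apply: mx_form_inj => v w; rewrite -[v]lvecK -[w]lvecK.
  by rewrite mx_form_tr !gramE // mulrC.
have [P PP] := hyp_mx_factor nz2 trG ulsubmx_gram.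
exists P => //; have := unitmx_gram.
by rewrite -PP !unitmx_mul => /andP[_].
Qed.

(** Both [gram] and [gram *m mulM a] are congruent to [H]; comparing determinants gives the norm as
    the square of [det P / det P0]. *)
Lemma corresp_normOK (T : 'M[k]_m) (a : L) : corresp T a -> normOK n a.
Proof.
move=> Ta; split; first exact: corresp_unit Ta.
case: Ta => P [uP [/isometry_mxP isoP _]].
have [P0 eqP0 uP0] := gram_factor; exists (\det P / \det P0).
have := congr1 determinant isoP; rewrite -eqP0 !det_mulmx !det_tr.
have nzH := det_hyp_mx_neq0 k n.+1; move: uP0; rewrite unitmxE unitfE => nzP0.
rewrite -/(normL n a) => eqd.
apply: (mulfI (mulf_neq0 nzH (mulf_neq0 nzP0 nzP0))).
transitivity (\det P0 * \det H * \det P0 * normL n a); first by ring.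
by rewrite -eqd; field.
Qed.

Lemma exists_corresp (a : L) : a \is a GRing.unit -> splitL n a ->
  exists T : 'M[k]_m, inVf f T /\ corresp T a.
Proof.
move=> ua [W [dimW isoW]].
have [X basisX] : exists X : n.+1.-tuple L, basis_of W X.
  by rewrite -dimW; exists (vbasis W); apply: vbasisP.
(* The rows are the coordinates of a basis of [W]; completing them makes the upper left block of the
   Gram matrix vanish, so it factors through [H]. *)
pose A : 'M[k]_(n.+1, m) := \matrix_(i < n.+1) (lcoord X`_i)^T.
have freeA : row_free A.
  apply: inj_row_free => v vA0; apply/rowP=> i; rewrite mxE.
  have /freeP freeX := basis_free basisX; apply: (freeX (v 0)).
  apply: (can_inj lcoordK); rewrite linear0 linear_sum; apply: trmx_inj.
  rewrite trmx0 -vA0 mulmx_sum_row linear_sum; apply: eq_bigr => j _.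
  by rewrite rowK !linearZ.
have isoA : A *m (gram *m mulM a) *m A^T = 0.
  apply/matrixP=> i j; rewrite [RHS]mxE.
  have -> : (A *m (gram *m mulM a) *m A^T) i j =
      ((lcoord X`_i)^T *m (gram *m mulM a) *m lcoord X`_j) 0 0.
    have -> : (lcoord X`_i)^T = row i A by rewrite rowK.
    have -> : lcoord X`_j = col j A^T by rewrite -tr_row rowK trmxK.
    by rewrite -row_mul mxE [RHS]mxE; apply: eq_bigr => l _; rewrite !mxE.
  by rewrite gram_mulM // isoW // (basis_mem basisX) // mem_nth ?size_tuple.
have [Q uQ Q0] := rebase_isotropic freeA isoA.
have trG := tr_gram_mulM a.
have symQ : (Q *m (gram *m mulM a) *m Q^T)^T = Q *m (gram *m mulM a) *m Q^T.
  by rewrite !trmx_mul trmxK -trmx_mul trG mulmxA.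
have [P0 eqP0] := hyp_mx_factor nz2 symQ Q0.
pose P := P0 *m (invmx Q)^T.
have PP : P^T *m H *m P = gram *m mulM a.
  rewrite /P trmx_mul trmxK -!mulmxA (mulmxA H) (mulmxA P0^T) (mulmxA P0^T) eqP0.
  by rewrite !mulmxA mulVmx // mul1mx -mulmxA -trmx_mul mulVmx // trmx1 mulmx1.
have uP : P \in unitmx.
  have : gram *m mulM a \in unitmx.
    by rewrite unitmx_mul unitmx_gram // unitmx_mulM.
  by rewrite -PP !unitmx_mul => /andP[_].
clearbody P; pose T := P *m mulM betaL *m invmx P; exists T.
have homP x : P *m lcoord (betaL * x) = T *m (P *m lcoord x).
  by rewrite /T -!mulmxA mulKmx // mulM_lcoord.
have isoP := (isometry_mxP P a).2 PP.
split; last by exists P.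
split=> [v w|].
  pose x := lvec (invmx P *m v); pose y := lvec (invmx P *m w).
  have -> : v = P *m lcoord x by rewrite lvecK mulKVmx.
  have -> : w = P *m lcoord y by rewrite lvecK mulKVmx.
  by rewrite -!homP !isoP !formL_topcoef; congr (topcoef _); ring.
(* By Cayley-Hamilton [char_poly T] kills [T], hence its class in [L] is zero. Equality follows
   since both polynomials are monic of degree [m]. *)
have f_char : f %| char_poly T.
  rewrite -in_qpoly_eq0; apply/eqP/(can_inj lcoordK).
  apply: (can_inj (mulKmx uP)); rewrite linear0 mulmx0 -[inL _]mulr1.
  by rewrite (beta_hom_horner homP) Cayley_Hamilton mul0mx.
apply/eqP; rewrite eq_sym -eqp_monic ?char_poly_monic //.
by rewrite -dvdp_size_eqp // size_f size_char_poly.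
Qed.

Lemma corresp_exists (T : 'M[k]_m) : inVf f T -> exists a : L, corresp T a.
Proof.
case=> saT charT.
have charTt : char_poly T^T = f by rewrite char_poly_trmx.
(* [cyclic_vector] yields row vectors, so it is applied to the transpose to obtain a cyclic column
   [u] for [T]. *)
have [u0 u0_min] : exists v : 'rV_m, forall h : {poly k},
  v *m horner_mx T^T h = 0 -> char_poly T^T %| h.
  by apply: (@cyclic_vector _ (n + n.+1)); rewrite charTt.
rewrite charTt in u0_min; pose u := u0^T.
have u_min (h : {poly k}) : horner_mx T h *m u = 0 -> f %| h.
  move=> hu0; apply: u0_min; apply: trmx_inj.
  by rewrite trmx0 horner_mx_tr trmx_mul trmxK.
(* [P] sends the class of [h] to [h(T) u]; cyclicity of [u] makes it injective. *)
pose P : 'M[k]_m := \matrix_(i, j) (horner_mx T 'X^j *m u) i 0.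
have PE (x : L) : P *m lcoord x = horner_mx T (x : {poly k}) *m u.
  have -> : (x : {poly k}) = \poly_(i < m) (x : {poly k})`_i.
    apply/polyP=> i; rewrite coef_poly.
    by case: ltnP => // le_m_i; rewrite nth_default // (leq_trans (size_qpoly x)).
  rewrite poly_def linear_sum mulmx_suml; apply/colP=> i.
  rewrite mxE summxE; apply: eq_bigr => j _.
  by rewrite linearZ /= -scalemxAl !mxE mulrC.
have uP : P \in unitmx.
  apply: unitmx_inj_col => v Pv0; rewrite -[v]lvecK.
  have /eqP -> : lvec v == 0; last by rewrite linear0.
  rewrite -[lvec v]in_qpolyK in_qpoly_eq0; apply: u_min.
  by rewrite -PE lvecK.
have Tf0 : horner_mx T f = 0.
  by have := @Cayley_Hamilton _ (n + n.+1) T; rewrite charT.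
have hornerL (p : {poly k}) : horner_mx T (inL p : {poly k}) = horner_mx T p.
  have : f %| p - (inL p : {poly k}).
    by rewrite -in_qpoly_eq0 linearB [X in _ - X]in_qpolyK subrr.
  case/dvdpP=> q /(congr1 (horner_mx T)); rewrite rmorphB rmorphM /= Tf0 mulr0.
  by move/eqP; rewrite subr_eq0 => /eqP.
have hornerM (x y : L) : horner_mx T (x * y : L) =
    horner_mx T (x : {poly k}) *m horner_mx T (y : {poly k}).
  by rewrite -[x in LHS]in_qpolyK -[y in LHS]in_qpolyK -rmorphM hornerL rmorphM.
have saH : T^T *m H = H *m T.
  apply: mx_form_inj => v w; have := saT v w.
  by rewrite !bformE trmx_mul !mulmxA.
have bform_horner (p : {poly k}) v w :
    bform (horner_mx T p *m v) w = bform v (horner_mx T p *m w).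
  rewrite !bformE trmx_mul -[_ *m H]mulmxA.
  by rewrite (@horner_mx_selfadjoint _ (n + n.+1)) // !mulmxA.
(* The dual basis represents the functional sending [z] to the pairing of [u] with [z(T) u] as
   [topcoef (a * z)]. *)
pose a : L := \sum_(j < m) (u^T *m H *m P) 0 j *: dual_beta j.
have topcoef_a (z : L) : topcoef (a * z) = bform u (P *m lcoord z).
  rewrite bformE mulmxA mxE mulr_suml linear_sum; apply: eq_bigr => j _.
  rewrite -scalerAl linearZ /= topcoef_dual_beta //; congr (_ * _).
  by rewrite mxE.
exists a, P; split=> //; split=> [x y|x].
  by rewrite formL_topcoef -mulrA topcoef_a !PE bform_horner hornerM mulmxA.
by rewrite !PE hornerM -in_qpolyX hornerL horner_mx_X mulmxA.
Qed.

Lemma corresp_equiv (T1 T2 : 'M[k]_m) (a1 a2 : L) :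
  corresp T1 a1 -> corresp T2 a2 -> (POequiv T1 T2 <-> sameclass a1 a2).
Proof.
case=> P1 [uP1 [isoP1 homP1]] [P2 [uP2 [isoP2 homP2]]]; split.
  case=> g [[ug [lam [nz_lam hg]]] DT2].
  have homg x : (g *m P1) *m lcoord (betaL * x) = T2 *m (g *m P1 *m lcoord x).
    by rewrite DT2 -!mulmxA homP1 mulKmx // !mulmxA.
  (* The map [P2^-1 g P1] commutes with multiplication by [beta], so it is multiplication by its
     value [c] at [1]. *)
  pose c := lvec (invmx P2 *m (g *m P1 *m lcoord 1)).
  have gE x : g *m P1 *m lcoord x = P2 *m lcoord (x * c).
    rewrite -[x]in_qpolyK (beta_hom_horner homP2) lvecK mulKVmx //.
    by rewrite -(beta_hom_horner homg) mulr1.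
  have uc : c \is a GRing.unit.
    apply: unitr_inj => b cb0; apply: (can_inj lcoordK).
    have ugP1 : g *m P1 \in unitmx by rewrite unitmx_mul ug.
    by apply: (can_inj (mulKmx ugP1)); rewrite gE mulrC cb0 !(linear0, mulmx0).
  (* The similitude identity is tested on the pair [1, y] for every [y]; nondegeneracy of [topcoef]
     gives the equality in [L]. *)
  have eq_a : lam *: a1 = c ^+ 2 * a2.
    apply/eqP; rewrite -subr_eq0; apply/eqP.
    apply: topcoef_eq0 => y.
    have := bform_similitude (P1 *m lcoord 1) (P1 *m lcoord y) hg.
    rewrite !mulmxA !gE isoP2 isoP1 !formL_topcoef => eq_coef.
    rewrite mulrBl linearB -scalerAl linearZ /= -[a1]mulr1 -eq_coef.
    by apply/eqP; rewrite subr_eq0; apply/eqP; congr (topcoef _); ring.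
  exists c, lam^-1; split=> //; split; first by rewrite invr_eq0.
  by rewrite -eq_a scalerA mulVf // scale1r.
(* Conversely, multiplication by [c] carried to U is a similitude with multiplier [t^-1]. *)
case=> c [t [uc [nz_t Da1]]]; exists (P2 *m mulM c *m invmx P1).
set g := _ *m invmx P1.
have ug : g \in unitmx by rewrite !unitmx_mul uP2 unitmx_inv uP1 unitmx_mulM.
have gE x : g *m (P1 *m lcoord x) = P2 *m lcoord (c * x).
  by rewrite /g -!mulmxA mulKmx // mulM_lcoord.
clearbody g; split; last first.
  rewrite -[LHS](mulmxK ug); congr (_ *m _); apply: mx_col_inj => v.
  have -> : v = P1 *m lcoord (lvec (invmx P1 *m v)) by rewrite lvecK mulKVmx.
  by rewrite -!mulmxA -homP1 !gE -homP2 mulrCA.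
split=> //; exists t^-1; split=> [|v]; first by rewrite invr_eq0.
(* Doubling turns the claim about [hypQ] into one about [bform] on the diagonal. *)
apply: (mulfI nz2); rewrite mulrCA -!bform_diag.
have -> : v = P1 *m lcoord (lvec (invmx P1 *m v)) by rewrite lvecK mulKVmx.
rewrite gE isoP2 isoP1 !formL_topcoef Da1 -!scalerAl linearZ /= mulKf //.
by congr (topcoef _); ring.
Qed.

End Etale.

Theorem theorem2p6 (k : fieldType) (n : nat) (f : {poly k}) :
  (2%:R : k) != 0 ->
  f \is monic -> size f = (n.+1 + n.+1).+1 -> separable_poly f ->
  (exists Phi : 'M[k]_(n.+1 + n.+1) -> {poly %/ f},
     (forall T, inVf f T -> normOK n (Phi T) /\ splitL n (Phi T)) /\
     (forall alpha : {poly %/ f}, normOK n alpha -> splitL n alpha ->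
        exists T, inVf f T /\ sameclass (Phi T) alpha) /\
     (forall T1 T2, inVf f T1 -> inVf f T2 ->
        (POequiv T1 T2 <-> sameclass (Phi T1) (Phi T2))) /\
     (forall T, inVf f T -> corresp T (1 : {poly %/ f}) -> sameclass (Phi T) 1) /\
     (forall T alpha, inVf f T -> corresp T alpha -> sameclass (Phi T) alpha)) /\
  (forall (T1 T2 : 'M[k]_(n.+1 + n.+1)) (a1 a2 : {poly %/ f}), inVf f T1 -> inVf f T2 ->
     corresp T1 a1 -> corresp T2 a2 ->
     (POequiv T1 T2 <-> sameclass a1 a2)).

Proof.
move=> nz2 f_monic size_f f_sep.
have equivP := @corresp_equiv k n f f_monic size_f f_sep nz2.
split; last by move=> T1 T2 a1 a2 _ _; apply: equivP.
(* A class is chosen for each operator; [1] only witnesses that [L] is inhabited. *)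
pose Phi (T : 'M[k]_(n.+1 + n.+1)) := epsilon (inhabits (1 : {poly %/ f})) (corresp T).
have PhiP T : inVf f T -> corresp T (Phi T).
  by move=> VfT; apply: epsilon_spec; apply: corresp_exists VfT.
(* Independence of the choice: the identity is a similitude from [T] to itself, so any two classes
   of [T] agree. *)
have PhiE T alpha : inVf f T -> corresp T alpha -> sameclass (Phi T) alpha.
  move=> VfT Ta; apply/(equivP _ _ _ _ (PhiP _ VfT) Ta); exists 1%:M; split.
    split; first exact: unitmx1.
    by exists 1; split=> [|v]; rewrite ?oner_neq0 // mul1mx mul1r.
  by rewrite mul1mx invmx1 mulmx1.
exists Phi; split=> [T VfT|].
  by split; [apply: corresp_normOK (PhiP _ VfT) | apply: corresp_splitL (PhiP _ VfT)].
split=> [alpha [ua _] split_alpha|].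
  have [T [VfT Ta]] := exists_corresp f_monic size_f f_sep nz2 ua split_alpha.
  by exists T; split=> //; apply: PhiE.
split=> [T1 T2 Vf1 Vf2|]; first exact: equivP (PhiP _ Vf1) (PhiP _ Vf2).
by split=> [T VfT|]; apply: PhiE.
Qed.
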